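(* Let $\mathcal A:\mathbb R^{n_1\times n_2}\to\mathbb R^m$ be linear and let $\mathbf X^0$ have rank at most $r$. If $\mathcal A$ satisfies the matrix RIP with $\delta_{2r}<0.4404$ and $\alpha\ge 10\|\mathbf X^0\|_2$ ($\alpha>0$), then $\mathbf X^0$ is the unique solution of problem (N2) with $\mathbf b=\mathcal A(\mathbf X^0)$.
   Context: Problem (N2) is $\min_{\mathbf X}\{\|\mathbf X\|_*+\frac{1}{2\alpha}\|\mathbf X\|_F^2:\ \mathcal A(\mathbf X)=\mathbf b\}$. The matrix RIP constant $\delta_r$ is the smallest value with $(1-\delta_r)\|\mathbf X\|_F^2\le\|\mathcal A(\mathbf X)\|_2^2\le(1+\delta_r)\|\mathbf X\|_F^2$ for all $\mathbf X$ of rank at most $r$. $\|\cdot\|_*$, $\|\cdot\|_F$, $\|\cdot\|_2$ are nuclear, Frobenius, spectral norms. *)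

(* Defs.v *)
From HB Require Import structures.
From mathcomp Require Import all_boot all_order all_algebra.
Set Implicit Arguments. Unset Strict Implicit. Unset Printing Implicit Defensive.
Import Order.TTheory GRing.Theory Num.Theory.
Local Open Scope ring_scope.

(* Ambient scalars: C is any numeric algebraically closed field (e.g. algC or
   the complex numbers); "real" matrices are those with entries in Num.real. *)

Definition frob2 {C : numClosedFieldType} {n1 n2 : nat} (X : 'M[C]_(n1, n2)) : C :=
  \sum_(i < n1) \sum_(j < n2) `|X i j| ^+ 2.

Definition vnorm2 {C : numClosedFieldType} {m : nat} (v : 'cV[C]_m) : C :=
  \sum_(i < m) `|v i 0| ^+ 2.

Definition singvals {C : numClosedFieldType} {n1 n2 : nat} (X : 'M[C]_(n1, n2))
  : 'rV[C]_n2 :=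
  \row_j sqrtC (spectral_diag ((map_mx Num.conj X)^T *m X) 0 j).

Definition nucnorm {C : numClosedFieldType} {n1 n2 : nat} (X : 'M[C]_(n1, n2)) : C :=
  \sum_(j < n2) singvals X 0 j.

Definition specnorm {C : numClosedFieldType} {n1 n2 : nat} (X : 'M[C]_(n1, n2)) : C :=
  \big[Num.max/0]_(j < n2) singvals X 0 j.

Definition realmat {C : numClosedFieldType} {n1 n2 : nat} (X : 'M[C]_(n1, n2)) : Prop :=
  forall i j, X i j \is Num.real.

Definition realvec {C : numClosedFieldType} {m : nat} (v : 'cV[C]_m) : Prop :=
  forall i, v i 0 \is Num.real.

Definition RIP_holds {C : numClosedFieldType} {n1 n2 m : nat}
  (A : 'M[C]_(n1, n2) -> 'cV[C]_m) (k : nat) (d : C) : Prop :=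
  forall X : 'M[C]_(n1, n2), realmat X -> (\rank X <= k)%N ->
    (1 - d) * frob2 X <= vnorm2 (A X) /\ vnorm2 (A X) <= (1 + d) * frob2 X.

Definition RIP_const {C : numClosedFieldType} {n1 n2 m : nat}
  (A : 'M[C]_(n1, n2) -> 'cV[C]_m) (k : nat) (d : C) : Prop :=
  0 <= d /\ RIP_holds A k d /\
  (forall d' : C, 0 <= d' -> RIP_holds A k d' -> d <= d').

Definition objN2 {C : numClosedFieldType} {n1 n2 : nat} (alpha : C)
  (X : 'M[C]_(n1, n2)) : C :=
  nucnorm X + frob2 X / (2 * alpha).

Definition unique_sol_N2 {C : numClosedFieldType} {n1 n2 m : nat}
  (A : 'M[C]_(n1, n2) -> 'cV[C]_m) (b : 'cV[C]_m) (alpha : C)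
  (X0 : 'M[C]_(n1, n2)) : Prop :=
  realmat X0 /\ A X0 = b /\
  forall X : 'M[C]_(n1, n2), realmat X -> A X = b -> X != X0 ->
    objN2 alpha X0 < objN2 alpha X.

(* Main.v *)
Require Import Defs.
From HB Require Import structures.
From mathcomp Require Import all_boot all_order all_algebra.
From mathcomp Require Import ring lra.
Set Implicit Arguments. Unset Strict Implicit. Unset Printing Implicit Defensive.
Import Order.TTheory GRing.Theory Num.Theory.
Local Open Scope ring_scope.

(** Write a competitor as [X0 + H] with [A H = 0], and let [K] be the sum of the [r]
    largest singular values [s_j] of [H] and [L] the sum of the others.
    - Mirsky: [|X0 + H|_* >= |X0|_* - K + L]. Pair [X0 + H] with an orthogonal [W]
      that sends the right singular vectors of [X0] to the left ones and differs from
      an orthogonal extension of the singular pairing of [H] by [r] reflections only,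
      so that [\sum_j (1 - <u_j, W v_j>) <= 2 r].
    - Ky Fan: [<X0, H> >= - |X0|_2 K].
    - Null space property: [L >= 1.1 K], because of the RIP restricted to
      combinations of the rank-one terms of the SVD of [H]; the argument works up to
      [delta < 1 / 2.1].
    Since [|X0|_2 <= alpha / 10], the objective at [X0 + H] exceeds that at [X0] by at
    least [|H|_F^2 / (2 alpha) > 0].
    All this takes place over the real elements [realOf C] of [C], an ordered field
    in which nonnegative elements have square roots and, by diagonalization over [C],
    symmetric matrices have eigenvalues; this suffices for a real SVD. *)

(** * Frobenius product and extension of isometries *)

Section RealMatrices.
Variable R : realFieldType.

Definition frob m n (A B : 'M[R]_(m, n)) : R := \tr (A^T *m B).

Lemma frobE m n (A B : 'M[R]_(m, n)) : frob A B = \sum_i \sum_j A i j * B i j.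
Proof.
rewrite /frob /mxtrace exchange_big; apply: eq_bigr => j _.
by rewrite mxE; apply: eq_bigr => i _; rewrite mxE.
Qed.

Lemma frobC m n (A B : 'M[R]_(m, n)) : frob A B = frob B A.
Proof. by rewrite /frob -mxtrace_tr trmx_mul trmxK. Qed.

Lemma frobDr m n (A B B' : 'M[R]_(m, n)) : frob A (B + B') = frob A B + frob A B'.
Proof. by rewrite /frob mulmxDr mxtraceD. Qed.

Lemma frobNr m n (A B : 'M[R]_(m, n)) : frob A (- B) = - frob A B.
Proof. by rewrite /frob mulmxN raddfN. Qed.

Lemma frobZr m n a (A B : 'M[R]_(m, n)) : frob A (a *: B) = a * frob A B.
Proof. by rewrite /frob -scalemxAr mxtraceZ. Qed.

Lemma frobDl m n (A A' B : 'M[R]_(m, n)) : frob (A + A') B = frob A B + frob A' B.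
Proof. by rewrite frobC frobDr !(frobC B). Qed.

Lemma frobNl m n (A B : 'M[R]_(m, n)) : frob (- A) B = - frob A B.
Proof. by rewrite frobC frobNr frobC. Qed.

Lemma frobZl m n a (A B : 'M[R]_(m, n)) : frob (a *: A) B = a * frob A B.
Proof. by rewrite frobC frobZr frobC. Qed.

Lemma frob_mull m n p (A : 'M[R]_(m, n)) (B : 'M_(n, p)) D :
  frob (A *m B) D = frob B (A^T *m D).
Proof. by rewrite /frob trmx_mul mulmxA. Qed.

Lemma frob_ge0 m n (A : 'M[R]_(m, n)) : 0 <= frob A A.
Proof.
by rewrite frobE; apply: sumr_ge0 => i _; apply: sumr_ge0 => j _; rewrite -expr2 sqr_ge0.
Qed.

Lemma frob_eq0 m n (A : 'M[R]_(m, n)) : (frob A A == 0) = (A == 0).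
Proof.
apply/eqP/eqP => [|->]; last by rewrite /frob mulmx0 mxtrace0.
rewrite frobE => A0; apply/matrixP => i j; rewrite mxE.
have row_ge0 i' : 0 <= \sum_j A i' j * A i' j.
  by apply: sumr_ge0 => j' _; rewrite -expr2 sqr_ge0.
have rowi0 : \sum_j A i j * A i j = 0.
  exact: (psumr_eq0P (fun i' _ => row_ge0 i') A0).
apply/eqP; rewrite -sqrf_eq0 expr2; apply/eqP.
apply: (psumr_eq0P _ rowi0) => // j' _.
by rewrite -expr2 sqr_ge0.
Qed.

(** Stands in for Cauchy-Schwarz without square roots: it is applied to pairs of equal norm, where
    it is just as sharp. *)
Lemma frob_le m n (A B : 'M[R]_(m, n)) : 2 * frob A B <= frob A A + frob B B.
Proof.
have := frob_ge0 (A - B).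
rewrite frobDl !frobDr !frobNl !frobNr (frobC B A); lra.
Qed.

Lemma mx11_frob n (u v : 'cV[R]_n) : u^T *m v = (frob u v)%:M.
Proof. by rewrite [LHS]mx11_scalar /frob trace_mx11. Qed.

(* The Householder reflection along [g - R f] sends [R f] to [g], fixes what the
   previous steps have achieved, and lowers the trace by at most 2. *)
Lemma isometry_extension N k (F G : 'M[R]_(N, k)) : F^T *m F = G^T *m G ->
  exists Q : 'M[R]_N,
    [/\ Q^T *m Q = 1%:M, Q *m F = G & N%:R - 2 * k%:R <= \tr Q].
Proof.
elim: k F G => [|k IHk] F G FG.
  exists 1%:M; split; first by rewrite trmx1 mulmx1.
    by rewrite mul1mx (thinmx0 F) (thinmx0 G).
  by rewrite mxtrace1 mulr0 subr0.
rewrite -[k.+1]/(1 + k)%N in F G FG *.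
rewrite -[F]hsubmxK -[G]hsubmxK !tr_row_mx !mul_col_row in FG.
have /eq_block_mx[ffgg fFgG _ FFGG] := FG.
have [Q [QQ QF trQ]] := IHk _ _ FFGG.
rewrite -[F]hsubmxK -[G]hsubmxK.
set f := lsubmx F in ffgg fFgG *; set g := lsubmx G in ffgg fFgG *.
set F' := rsubmx F in fFgG QF *; set G' := rsubmx G in fFgG QF *.
set y := Q *m f.
have yy : y^T *m y = g^T *m g.
  by rewrite /y trmx_mul -mulmxA (mulmxA Q^T) QQ mul1mx.
have yG : y^T *m G' = g^T *m G'.
  by rewrite -QF /y trmx_mul -mulmxA (mulmxA Q^T) QQ mul1mx fFgG QF.
have k1E : k.+1%:R = k%:R + 1 :> R by rewrite natr1.
have [yg|yNg] := eqVneq y g.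
  exists Q; split => //; first by rewrite mul_mx_row QF -/y yg.
  by move: trQ; rewrite -[(1 + k)%N]/k.+1 k1E; lra.
pose w := y - g; pose c := frob w w.
have c_gt0 : 0 < c by rewrite lt_def frob_ge0 frob_eq0 subr_eq0 yNg.
have wG : w^T *m G' = 0 by rewrite /w linearB /= mulmxBl yG subrr.
have wy : 2 * frob w y = c.
  have yyE : frob y y = frob g g by rewrite /frob yy.
  rewrite /c /w !frobDl !frobDr !frobNl !frobNr yyE (frobC y g); ring.
pose S : 'M[R]_N := 1%:M - (2 / c) *: (w *m w^T).
have ST : S^T = S by rewrite /S linearB /= trmx1 linearZ /= trmx_mul trmxK.
have SE p (A : 'M_(N, p)) : S *m A = A - (2 / c) *: (w *m (w^T *m A)).
  by rewrite /S mulmxBl mul1mx -scalemxAl mulmxA.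
have Sw : S *m w = - w.
  rewrite SE mx11_frob -/c -scalemx1 -scalemxAr mulmx1 scalerA divfK ?gt_eqF //.
  by rewrite scaler_nat mulr2n opprD addrA subrr add0r.
have SS : S *m S = 1%:M.
  by rewrite {2}/S mulmxBr mulmx1 -scalemxAr mulmxA Sw mulNmx scalerN opprK /S subrK.
have Sy : S *m y = g.
  have cwy : 2 / c * frob w y = 1 by rewrite mulrAC wy divff ?gt_eqF.
  rewrite SE mx11_frob -scalemx1 -scalemxAr mulmx1 scalerA cwy scale1r /w.
  by rewrite opprB addrC subrK.
have SG : S *m G' = G' by rewrite SE wG mulmx0 scaler0 subr0.
exists (S *m Q); split.
- by rewrite trmx_mul -mulmxA (mulmxA S^T) ST SS mul1mx.
- by rewrite mul_mx_row -!mulmxA QF SG -/y Sy.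
(* The trace drops by [(2 / c) <w, Q w>], at most 2 since [w] and [Q w] both have squared norm
   [c]. *)
rewrite SE linearB /= mxtraceZ mxtrace_mulC -mulmxA -/(frob w _).
have wQw : frob w (Q *m w) <= c.
  have := frob_le w (Q *m w); rewrite frob_mull mulmxA QQ mul1mx -/c => ?.
  by lra.
have : 2 / c * frob w (Q *m w) <= 2.
  by rewrite mulrAC ler_pdivrMr // ler_pM2l.
by move: trQ; rewrite -[(1 + k)%N]/k.+1 k1E; lra.
Qed.

(** * Singular value decompositions *)

(** The reduced SVD: the singular values are positive and unsorted, so [k] is the rank and
    [diag_mx s] is invertible. *)
Definition is_svd m n k (X : 'M[R]_(m, n)) (U : 'M_(m, k)) (s : 'rV_k) (V : 'M_(n, k)) :=
  [/\ U^T *m U = 1%:M, V^T *m V = 1%:M, forall j, 0 < s 0 j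
    & X = U *m diag_mx s *m V^T].

Lemma frob_diag_mul m n k (B : 'M[R]_(m, n)) (U : 'M_(m, k)) (d : 'rV_k) (V : 'M_(n, k)) :
  frob B (U *m diag_mx d *m V^T) = \sum_j d 0 j * (U^T *m B *m V) j j.
Proof.
rewrite frobC /frob !trmx_mul trmxK tr_diag_mx -!mulmxA mxtrace_mulC -!mulmxA.
by rewrite mul_diag_mx; apply: eq_bigr => j _; rewrite mxE mulmxA.
Qed.

Lemma frob_diag_svd m n k (U : 'M[R]_(m, k)) (d : 'rV_k) (V : 'M_(n, k)) :
  U^T *m U = 1%:M -> V^T *m V = 1%:M ->
  frob (U *m diag_mx d *m V^T) (U *m diag_mx d *m V^T) = \sum_j d 0 j ^+ 2.
Proof.
move=> UU VV; rewrite frob_diag_mul; apply: eq_bigr => j _.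
by rewrite -!mulmxA VV mulmx1 mulmxA UU mul1mx mxE eqxx mulr1n expr2.
Qed.

Lemma orthonormal_diag_le1 m k (P Q : 'M[R]_(m, k)) j :
  P^T *m P = 1%:M -> Q^T *m Q = 1%:M -> (P^T *m Q) j j <= 1.
Proof.
have frob_col (A B : 'M[R]_(m, k)) : frob (col j A) (col j B) = (A^T *m B) j j.
  by rewrite /frob trace_mx11 !mxE; apply: eq_bigr => i _; rewrite !mxE.
move=> PP QQ; have := frob_le (col j P) (col j Q).
by rewrite !frob_col PP QQ ![1%:M j j]mxE eqxx mulr1n; lra.
Qed.

(** Expand [|u - P P^T u|^2 >= 0] for the [j]-th column [u] of [U]. *)
Lemma bessel m k l (P : 'M[R]_(m, k)) (U : 'M_(m, l)) j :
  P^T *m P = 1%:M -> U^T *m U = 1%:M -> \sum_i (P^T *m U) i j ^+ 2 <= 1.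
Proof.
move=> PP UU; set u := col j U.
have uu : frob u u = 1.
  rewrite /frob trace_mx11; have /matrixP/(_ j j) := UU.
  by rewrite !mxE eqxx mulr1n => <-; apply: eq_bigr => i _; rewrite !mxE.
have -> : \sum_i (P^T *m U) i j ^+ 2 = frob (P^T *m u) (P^T *m u).
  rewrite frobE; apply: eq_bigr => i _; rewrite big_ord1 expr2.
  by congr (_ * _); rewrite !mxE; apply: eq_bigr => i' _; rewrite !mxE.
have := frob_ge0 (u - P *m (P^T *m u)).
rewrite frobDl !frobDr !frobNl !frobNr uu.
rewrite [frob (P *m _) u]frob_mull [frob u (P *m _)]frobC [frob (P *m _) u]frob_mull.
by rewrite [frob (P *m _) (P *m _)]frob_mull [P^T *m (P *m _)]mulmxA PP mul1mx; lra.
Qed.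

Lemma svd_size_le_rank m n k (X : 'M[R]_(m, n)) U (s : 'rV_k) V :
  is_svd X U s V -> (k <= \rank X)%N.
Proof.
case=> UU VV s_gt0 XE.
have D : diag_mx s = U^T *m X *m V.
  by rewrite XE !mulmxA UU mul1mx -mulmxA VV mulmx1.
have <- : \rank (diag_mx s) = k.
  apply: mxrank_unit; rewrite unitmxE det_diag unitfE.
  by apply/prodf_neq0 => i _; rewrite gt_eqF.
rewrite D; apply: leq_trans (mxrankM_maxl _ _) _; exact: mxrankM_maxr.
Qed.

(** The easy half of the duality between spectral and nuclear norms: the product is
    [\sum_j t_j (A^T O B)_jj], and no diagonal entry exceeds 1. *)
Lemma frob_orth_le N k (O Y : 'M[R]_N) A (t : 'rV_k) B :
  O^T *m O = 1%:M -> is_svd Y A t B -> frob O Y <= \sum_j t 0 j.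
Proof.
move=> OO [AA BB t_gt0 ->]; rewrite frob_diag_mul; apply: ler_sum => j _.
rewrite -[leRHS]mulr1 ler_pM2l // -mulmxA orthonormal_diag_le1 //.
by rewrite trmx_mul mulmxA -(mulmxA B^T) OO mulmx1.
Qed.

(* Since [\sum_j s_j c_j] is at most the sum of the [r] largest [s_j], this is the
   case of the Mirsky inequality where [X] has rank [r]. *)
Lemma svd_sum_perturb_square N r k l (X H : 'M[R]_N) P (sX : 'rV_r) Q
    U (sH : 'rV_k) V A (sY : 'rV_l) B :
  is_svd X P sX Q -> is_svd H U sH V -> is_svd (X + H) A sY B ->
  exists c : 'I_k -> R,
    [/\ forall j, 0 <= c j <= 1, \sum_j c j <= r%:R
      & \sum_j sX 0 j + \sum_j sH 0 j - 2 * (\sum_j sH 0 j * c j) <= \sum_j sY 0 j].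
Proof.
move=> [PP QQ _ XE] [UU VV sH_gt0 HE] svdY.
(* [O] extends the pairing of [v_j] with [u_j]. Once [T] maps [Q] to [O^T P], the product [O T] maps
   [Q] to [P], and [<u_j, O T v_j> = <v_j, T v_j>], which will be [1 - 2 c_j]. *)
have [O [OO OV _]] := @isometry_extension _ _ V U (etrans VV (esym UU)).
have OU : O^T *m U = V by rewrite -OV mulmxA OO mul1mx.
have OO' := mulmx1C OO.
have QP : Q^T *m Q = (O^T *m P)^T *m (O^T *m P).
  by rewrite trmx_mul trmxK mulmxA -(mulmxA P^T) OO' mulmx1 PP QQ.
have [T [TT TQ trT]] := isometry_extension QP.
have WW : (O *m T)^T *m (O *m T) = 1%:M.
  by rewrite trmx_mul mulmxA -(mulmxA T^T) OO mulmx1 TT.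
have diag_le1 (j : 'I_k) : (V^T *m (T *m V)) j j <= 1.
  apply: orthonormal_diag_le1 => //.
  by rewrite trmx_mul mulmxA -(mulmxA V^T) TT mulmx1.
have diag_geN1 (j : 'I_k) : - 1 <= (V^T *m (T *m V)) j j.
  rewrite lerNl; have -> : - (V^T *m (T *m V)) j j = (V^T *m (- (T *m V))) j j.
    by rewrite mulmxN !mxE.
  apply: orthonormal_diag_le1 => //.
  rewrite -mulmxN trmx_mul mulmxA -(mulmxA _ T^T) TT mulmx1.
  by rewrite [(- V)^T]linearN /= mulNmx mulmxN opprK VV.
exists (fun j => (1 - (V^T *m (T *m V)) j j) / 2); split.
- by move=> j; have := diag_le1 j; have := diag_geN1 j; lra.
- rewrite -mulr_suml sumrB sumr_const card_ord -/(\tr _).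
  (* [Z] projects onto the complement of the columns of [V], so [\tr T = \tr (V^T T V) + <Z, T Z>].
     The last term is at most [|Z|^2 = N - k], while [\tr T >= N - 2 r]. *)
  pose Z : 'M[R]_N := 1%:M - V *m V^T.
  have ZT : Z^T = Z by rewrite /Z linearB /= trmx1 trmx_mul trmxK.
  have ZZ : Z *m Z = Z.
    rewrite {2}/Z mulmxBr mulmx1 {2}/Z mulmxBl mul1mx mulmxA -(mulmxA V V^T V).
    by rewrite VV mulmx1 subrr subr0.
  have trZ : \tr Z = N%:R - k%:R.
    by rewrite /Z raddfB /= mxtrace1 mxtrace_mulC VV mxtrace1.
  have trTZ : frob Z (T *m Z) = \tr T - \tr (V^T *m (T *m V)).
    rewrite /frob ZT mxtrace_mulC -mulmxA ZZ /Z mulmxBr mulmx1 raddfB /=.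
    by rewrite mulmxA [in X in _ - X]mxtrace_mulC.
  have := frob_le Z (T *m Z).
  rewrite frob_mull mulmxA TT mul1mx trTZ {1 2}/frob ZT ZZ trZ.
  by lra.
have := frob_orth_le WW svdY; apply: le_trans.
rewrite frobDr {1}XE {1}HE !frob_diag_mul mulr_sumr -addrA -sumrB.
rewrite le_eqVlt; apply/orP; left; apply/eqP.
congr (_ + _); apply: eq_bigr => j _.
  by rewrite -!mulmxA TQ (mulmxA O) OO' mul1mx PP mxE eqxx mulr1.
have UO : U^T *m O = V^T by rewrite -OU trmx_mul trmxK.
by rewrite !mulmxA UO -mulmxA; field.
Qed.

(** An orthogonal map from right to left singular vectors needs a square matrix; placing [X] in a
    corner of one keeps its singular values. *)
Lemma is_svd_pad m n k (X : 'M[R]_(m, n)) U (s : 'rV_k) V : is_svd X U s V ->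
  is_svd (block_mx 0 X 0 0 : 'M_(m + n)) (col_mx U 0) s (col_mx 0 V).
Proof.
case=> UU VV s_gt0 XE; split => //.
- by rewrite tr_col_mx trmx0 mul_row_col mul0mx addr0.
- by rewrite tr_col_mx trmx0 mul_row_col mul0mx add0r.
- by rewrite tr_col_mx trmx0 mul_col_mx mul_col_row !mul0mx !mulmx0 -XE.
Qed.

Lemma svd_sum_perturb m n r k l (X H : 'M[R]_(m, n)) P (sX : 'rV_r) Q
    U (sH : 'rV_k) V A (sY : 'rV_l) B :
  is_svd X P sX Q -> is_svd H U sH V -> is_svd (X + H) A sY B ->
  exists c : 'I_k -> R,
    [/\ forall j, 0 <= c j <= 1, \sum_j c j <= r%:R
      & \sum_j sX 0 j + \sum_j sH 0 j - 2 * (\sum_j sH 0 j * c j) <= \sum_j sY 0 j].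
Proof.
move=> /is_svd_pad svdX /is_svd_pad svdH /is_svd_pad svdY.
apply: (svd_sum_perturb_square svdX svdH (A := col_mx A 0) (B := col_mx 0 B)).
by rewrite add_block_mx !addr0.
Qed.

(** With [p = P^T U] and [q = Q^T V], [<X, H> = \sum_j sH_j \sum_i sX_i p_ij q_ij], and
    [p_ij q_ij >= - (p_ij^2 + q_ij^2) / 2]. Bessel along columns gives [c_j <= 1], along rows
    [\sum_j c_j <= r]. *)
Lemma frob_svd_ge m n r k (X H : 'M[R]_(m, n)) P (sX : 'rV_r) Q
    U (sH : 'rV_k) V (b : R) :
  is_svd X P sX Q -> is_svd H U sH V -> (forall i, sX 0 i <= b) ->
  exists c : 'I_k -> R,
    [/\ forall j, 0 <= c j <= 1, \sum_j c j <= r%:R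
      & - (b * \sum_j sH 0 j * c j) <= frob X H].
Proof.
move=> [PP QQ sX_gt0 XE] [UU VV sH_gt0 HE] sX_le.
pose p := P^T *m U; pose q := Q^T *m V.
exists (fun j => (\sum_i p i j ^+ 2 + \sum_i q i j ^+ 2) / 2); split.
- move=> j; have := bessel j PP UU; have := bessel j QQ VV.
  have : 0 <= \sum_i p i j ^+ 2 by apply: sumr_ge0 => i _; exact: sqr_ge0.
  have : 0 <= \sum_i q i j ^+ 2 by apply: sumr_ge0 => i _; exact: sqr_ge0.
  by rewrite -/p -/q; lra.
- have tr_le k1 k2 k3 (A : 'M[R]_(k3, k1)) (B : 'M_(k3, k2)) :
    A^T *m A = 1%:M -> B^T *m B = 1%:M ->
    \sum_j \sum_i (A^T *m B) i j ^+ 2 <= k1%:R.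
    move=> AA BB; rewrite exchange_big -[k1 in leRHS]card_ord -sumr_const.
    apply: ler_sum => i _; apply: le_trans (bessel i BB AA).
    rewrite le_eqVlt; apply/orP; left; apply/eqP; apply: eq_bigr => j _.
    by rewrite -[A^T *m B]trmxK trmx_mul trmxK mxE.
  rewrite -mulr_suml big_split /=.
  by have := tr_le _ _ _ _ _ PP UU; have := tr_le _ _ _ _ _ QQ VV; rewrite -/p -/q; lra.
have diagE j : (U^T *m X *m V) j j = \sum_i sX 0 i * (p i j * q i j).
  have -> : U^T *m X *m V = p^T *m (diag_mx sX *m q).
    by rewrite XE /p /q trmx_mul trmxK !mulmxA.
  rewrite mxE; apply: eq_bigr => i _; rewrite mxE mul_diag_mx mxE; ring.
rewrite {1}HE frob_diag_mul mulr_sumr -sumrN; apply: ler_sum => j _.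
rewrite mulrCA -mulrN ler_pM2l // diagE -big_split /= mulr_suml mulr_sumr -sumrN.
apply: ler_sum => i _.
have si_gt0 := sX_gt0 i; have si_le := sX_le i.
have : 0 <= (b - sX 0 i) * (p i j ^+ 2 + q i j ^+ 2).
  by rewrite mulr_ge0 ?subr_ge0 ?addr_ge0 ?sqr_ge0.
have : 0 <= sX 0 i * (p i j + q i j) ^+ 2 by rewrite mulr_ge0 ?sqr_ge0 // ltW.
nra.
Qed.

(* [T] consists of [r] largest values of [s], or of all of them if there are
   fewer than [r]; [t] separates the two parts, with [t = 0] in the second case. *)
Definition is_top k (s : 'I_k -> R) r (T : {set 'I_k}) (t : R) :=
  [/\ 0 <= t, (#|T| <= r)%N, t * r%:R = t * #|T|%:R,
     forall j, j \in T -> t <= s j & forall j, j \notin T -> s j <= t].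

Lemma is_top_exists k (s : 'I_k -> R) r : (forall j, 0 <= s j) ->
  exists T t, is_top s r T t.
Proof.
move=> s_ge0; elim: r => [|r [T [t [t_ge0 Tr tE inT outT]]]].
  (* With [T] empty the threshold has to bound every [s j]; the sum does. *)
  exists set0, (\sum_j s j); split; rewrite ?cards0 //.
  - by apply: sumr_ge0.
  - by move=> j; rewrite inE.
  - by move=> j _; rewrite (bigD1 j) //= lerDl sumr_ge0.
have [j0 j0T|Tall] := pickP (fun j => j \notin T); last first.
  exists T, 0; split; rewrite ?mul0r // ?leqW // => j.
  by rewrite (Tall j).
pose j1 := [arg max_(j > j0 | j \notin T) s j]%O.
have [j1T j1max] : j1 \notin T /\ forall j, j \notin T -> s j <= s j1.
  by rewrite /j1; case: arg_maxP.
exists (j1 |: T), (s j1); split => //.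
- by rewrite cardsU1 j1T.
(* If [t] is nonzero then [T] already has [r] elements; otherwise the new threshold is 0 as well. *)
- rewrite cardsU1 j1T add1n -!natr1 !mulrDr; congr (_ + _).
  have [t0|tN0] := eqVneq t 0.
    have -> : s j1 = 0 by apply: le_anti; rewrite s_ge0 -t0 outT.
    by rewrite !mul0r.
  by rewrite (mulfI tN0 tE).
- by move=> j; rewrite !inE => /orP[/eqP->//|/inT]; apply: le_trans; exact: outT.
- by move=> j; rewrite !inE negb_or => /andP[_ /j1max].
Qed.

(** The threshold acts as a Lagrange multiplier: [(s_j - t) (c_j - [j \in T]) <= 0] for every [j],
    and [t (\sum_j c_j - #|T|) = t (\sum_j c_j - r) <= 0]. *)
Lemma is_top_sum k (s : 'I_k -> R) r T t (c : 'I_k -> R) : is_top s r T t ->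
  (forall j, 0 <= c j <= 1) -> \sum_j c j <= r%:R ->
  \sum_j s j * c j <= \sum_(j in T) s j.
Proof.
case=> t_ge0 _ tE inT outT c01 sumc.
have le_c j : s j * c j <= s j *+ (j \in T) + t * (c j - (j \in T)%:R).
  have /andP[c_ge0 c_le1] := c01 j.
  have [/inT st|/outT st] /= := boolP (j \in T); first by rewrite !mulr1n; nra.
  by rewrite !mulr0n; nra.
apply: le_trans (ler_sum _ (fun j _ => le_c j)) _.
have cardT : \sum_j (j \in T)%:R = #|T|%:R :> R.
  by rewrite -sum1_card [in RHS]big_mkcond natr_sum; apply: eq_bigr => j _; case: (j \in T).
rewrite big_split /= -mulr_sumr sumrB cardT mulrBr -tE [leRHS]big_mkcond /=.
under eq_bigr do rewrite mulrb.
by have := ler_wpM2l t_ge0 sumc; lra.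
Qed.

(** * Null space property and recovery *)

Definition sparse_rip m k (M : 'M[R]_(m, k)) (q : nat) (d : R) :=
  forall x : 'cV_k, (#|[set j | x j 0%R != 0%R]| <= q)%N ->
    (1 - d) * frob x x <= frob (M *m x) (M *m x) <= (1 + d) * frob x x.

Lemma frob_col k (x y : 'cV[R]_k) : frob x y = \sum_j x j 0 * y j 0.
Proof. by rewrite frobE; apply: eq_bigr => j _; rewrite big_ord1. Qed.

(* If [c := 11 / 10] violated the bound, the tail of [s] would lie in the polytope
   [0 <= v <= theta, \sum v <= r * theta] with [theta := c * a / r]; a linear
   functional is minimal there at a vector [w] with [r] entries [theta], whence
   [<M x, M w> <= - |M x|^2] for the head [x] of [s]. The RIP applied to
   [x + w / c] and [x - w / c] then forces [1 - d <= c * d]. *)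
Lemma rip_null_space m k r (M : 'M[R]_(m, k)) (d : R) (s : 'I_k -> R) T t :
  sparse_rip M (2 * r) d -> 0 <= d -> d < 4404%:R / 10000%:R ->
  (forall j, 0 <= s j) -> is_top s r T t -> M *m (\col_j s j) = 0 ->
  11%:R / 10%:R * \sum_(j in T) s j <= \sum_(j | j \notin T) s j.
Proof.
move=> rip d_ge0 d_lt s_ge0 [t_ge0 Tr tE inT outT] Ms0.
rewrite leNgt; apply/negP => tail_lt.
set a := \sum_(j in T) s j in tail_lt *; set tl := \sum_(j | _) _ in tail_lt *.
have tl_ge0 : 0 <= tl by apply: sumr_ge0.
have a_gt0 : 0 < a by lra.
have r_gt0 : 0 < r%:R :> R.
  rewrite ltr0n lt0n; apply: contraTneq a_gt0 => r0.
  move: Tr; rewrite r0 leqn0 cards_eq0 /a => /eqP->.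
  by rewrite big_set0 ltxx.
pose th := 11%:R / 10%:R * a / r%:R.
have th_gt0 : 0 < th by rewrite divr_gt0 // mulr_gt0 // divr_gt0 ?ltr0n.
have thr : th * r%:R = 11%:R / 10%:R * a by rewrite divfK ?gt_eqF.
have t_le : t <= th.
  have : t * r%:R <= a.
    by rewrite tE mulr_natr -sumr_const; apply: ler_sum.
  move=> tr_le; rewrite -(ler_pM2r r_gt0) thr; lra.
pose x : 'cV[R]_k := \col_j (if j \in T then s j else 0).
pose v : 'cV[R]_k := \col_j (if j \in T then 0 else s j).
have Mv : M *m v = - (M *m x).
  apply/eqP; rewrite -addr_eq0 -mulmxDr -Ms0; apply/eqP; congr (_ *m _).
  by apply/colP => j; rewrite !mxE; case: ifP => _; rewrite ?add0r ?addr0.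
(* [h] holds the coefficients of the functional [<M x, M y>] of [y], set to 0 on [T] to keep [w] off
   the head; [g] is its negative part. Minimizing over the polytope puts [th] on the [r] largest
   [g j]. *)
pose h j := if j \in T then 0 else (M^T *m (M *m x)) j 0.
pose g j := Num.max 0 (- h j).
have g_ge0 j : 0 <= g j by rewrite le_max lexx.
have [S [u topS]] := is_top_exists r g_ge0.
have [_ Sr _ _ _] := topS.
(* Entries of [S] where [g] vanishes, possibly in [T], are dropped at no cost. *)
pose S' := [set j in S | h j < 0].
have S'T j : j \in S' -> j \notin T.
  by rewrite inE /h => /andP[_]; case: ifP => //; rewrite ltxx.
have sumS' : \sum_(j in S) g j = - \sum_(j in S') h j.
  rewrite (bigID (fun j => h j < 0)) /= [X in _ + X]big1 => [|j /andP[_]].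
    rewrite addr0 -sumrN; apply: eq_big => [j|j /andP[_ hj]]; first by rewrite inE.
    by rewrite /g max_r // oppr_ge0 ltW.
  by rewrite -leNgt /g => hj; rewrite max_l // oppr_le0.
pose w : 'cV[R]_k := \col_j (if j \in S' then th else 0).
have Mx_dot (y : 'cV[R]_k) : (forall j, j \in T -> y j 0 = 0) ->
    frob (M *m x) (M *m y) = \sum_j y j 0 * h j.
  move=> yT; rewrite frobC frob_mull frob_col; apply: eq_bigr => j _.
  by rewrite /h; case: ifP => // /yT ->; rewrite !mul0r.
have wT j : j \in T -> w j 0 = 0.
  by move=> jT; rewrite mxE; case: ifP => // /S'T; rewrite jT.
have vT j : j \in T -> v j 0 = 0 by move=> jT; rewrite mxE jT.
have MxMw : frob (M *m x) (M *m w) = - (th * \sum_(j in S) g j).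
  rewrite Mx_dot // sumS' mulrN opprK mulr_sumr [RHS]big_mkcond.
  by apply: eq_bigr => j _; rewrite mxE; case: ifP => _; rewrite ?mul0r.
have v_ge0 j : 0 <= v j 0 by rewrite mxE; case: ifP.
have MxMv : - (th * \sum_(j in S) g j) <= frob (M *m x) (M *m v).
  have cbnd j : 0 <= v j 0 / th <= 1.
    apply/andP; split; first by rewrite divr_ge0 ?v_ge0 ?ltW.
    rewrite ler_pdivrMr // mul1r mxE; case: ifPn => [_|/outT sj]; first exact: ltW.
    exact: le_trans t_le.
  have csum : \sum_j v j 0 / th <= r%:R.
    rewrite -mulr_suml ler_pdivrMr // mulrC thr ltW //.
    apply: le_lt_trans tail_lt; rewrite /tl [leRHS]big_mkcond /=.
    by apply: ler_sum => j _; rewrite mxE; case: ifP.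
  have := is_top_sum topS cbnd csum.
  rewrite Mx_dot // -(ler_pM2l th_gt0) => top_le.
  apply: le_trans (_ : - (th * \sum_j g j * (v j 0 / th)) <= _); first by rewrite lerN2.
  rewrite mulr_sumr -sumrN; apply: ler_sum => j _.
  have -> : th * (g j * (v j 0 / th)) = v j 0 * g j by field; rewrite gt_eqF.
  by rewrite -mulrN ler_wpM2l // lerNl le_max lexx orbT.
have xw0 : frob x w = 0.
  rewrite frob_col big1 // => j _; rewrite !mxE.
  by case: ifP => [/wT|_]; rewrite ?mul0r // mxE => ->; rewrite mulr0.
have xx : a ^+ 2 <= r%:R * frob x x.
  have : 0 <= \sum_(j in T) (s j - a / r%:R) ^+ 2 by apply: sumr_ge0 => j _; exact: sqr_ge0.
  have -> : \sum_(j in T) (s j - a / r%:R) ^+ 2 =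
      frob x x - 2 * a * (a / r%:R) + #|T|%:R * (a / r%:R) ^+ 2.
    transitivity (\sum_(j in T) (s j ^+ 2 - s j * (2 * (a / r%:R)) + (a / r%:R) ^+ 2)).
      by apply: eq_bigr => j _; ring.
    rewrite big_split sumrB /= -mulr_suml -/a sumr_const -mulr_natl frob_col.
    rewrite [\sum_(j in T) _]big_mkcond; congr (_ - _ + _); [|by ring..].
    by apply: eq_bigr => j _; rewrite mxE; case: ifP => _; rewrite ?mul0r ?expr2.
  have Tr' : #|T|%:R * (a / r%:R) ^+ 2 <= r%:R * (a / r%:R) ^+ 2.
    by rewrite ler_wpM2r ?sqr_ge0 // ler_nat.
  move=> sq_ge0; pose y := 2 * a * (a / r%:R) - r%:R * (a / r%:R) ^+ 2.
  apply: le_trans (_ : r%:R * y <= _).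
    rewrite le_eqVlt; apply/orP; left; apply/eqP; rewrite /y; field.
    by rewrite gt_eqF.
  by rewrite ler_pM2l // /y; lra.
have xx_gt0 : 0 < frob x x.
  by rewrite -(pmulr_rgt0 _ r_gt0); apply: lt_le_trans xx; rewrite exprn_gt0.
(* The inverse of 11/10, so that [|e w|^2 <= r (e th)^2 = a^2 / r <= |x|^2]. *)
pose e : R := 10%:R / 11%:R.
have ww : e ^+ 2 * frob w w <= frob x x.
  have -> : frob w w = #|S'|%:R * th ^+ 2.
    rewrite frob_col mulr_natl -sumr_const [RHS]big_mkcond.
    by apply: eq_bigr => j _; rewrite mxE; case: ifP => _; rewrite ?mul0r ?expr2.
  have S'r : #|S'|%:R * th ^+ 2 <= r%:R * th ^+ 2.
    rewrite ler_wpM2r ?sqr_ge0 // ler_nat; apply: leq_trans Sr.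
    by apply: subset_leq_card; apply/subsetP => j; rewrite inE => /andP[].
  apply: le_trans (_ : e ^+ 2 * (r%:R * th ^+ 2) <= _).
    by rewrite ler_wpM2l ?sqr_ge0.
  rewrite -(ler_pM2l r_gt0); apply: le_trans xx; rewrite le_eqVlt; apply/orP; left.
  by apply/eqP; rewrite /e /th; field; rewrite gt_eqF.
have rip_xw (b : R) : (1 - d) * (frob x x + b ^+ 2 * frob w w) <=
    frob (M *m x) (M *m x) + 2 * b * frob (M *m x) (M *m w)
    + b ^+ 2 * frob (M *m w) (M *m w) <= (1 + d) * (frob x x + b ^+ 2 * frob w w).
  have := rip (x + b *: w); rewrite mulmxDr -scalemxAr.
  rewrite !frobDl !frobDr !frobZl !frobZr (frobC w x) xw0 !mulr0 addr0 add0r.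
  rewrite (frobC (M *m w)) => xwrip.
  have := xwrip _; set lhs := (_ <= 2 * r)%N.
  have card_xw : lhs.
    apply: leq_trans (_ : #|T :|: S'| <= _)%N.
      apply: subset_leq_card; apply/subsetP => j; rewrite !inE !mxE; apply: contraR.
      rewrite negb_or => /andP[/negPf->]; rewrite inE => /negPf ->.
      by rewrite mulr0 addr0.
    rewrite mul2n -addnn; apply: leq_trans (leq_card_setU _ _) _.
    apply: leq_add => //; apply: leq_trans Sr; apply: subset_leq_card.
    by apply/subsetP => j; rewrite inE => /andP[].
  move=> /(_ card_xw); congr (is_true _); congr (_ && _); congr (_ <= _); ring.
have := rip_xw e; have := rip_xw (- e); have := rip_xw 0.
rewrite sqrrN => /andP[rip0 _] /andP[_ ripN] /andP[ripP _].
have MxMx : frob (M *m x) (M *m x) = - frob (M *m x) (M *m v).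
  by rewrite Mv frobNr opprK.
move: MxMv MxMx ripN ripP; rewrite -MxMw; move: rip0.
rewrite mulr0 !mul0r expr0n !mul0r !addr0.
set n := frob x x in ww xx_gt0 *; set W := frob w w in ww *.
set q := frob (M *m w) _; set p := frob (M *m x) (M *m x).
set i := frob (M *m x) (M *m w); set z := frob _ (M *m v).
move=> rip0 iz pz ripN ripP.
(* The lower bound at [e] minus the upper bound at [- e]. With [i <= - p <= - (1 - d) n] it forces
   [1 - d <= 11 / 10 * d], impossible for [d < 1 / 2.1]. *)
have en : 4 * e * i >= - (4 * d * n).
  have : d * (e ^+ 2 * W) <= d * n by rewrite ler_wpM2l.
  lra.
have dn : d * n <= 4404%:R / 10000%:R * n by rewrite ler_pM2r // ltW.
rewrite /e in en; lra.
Qed.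

Lemma mxrank_diag_le k (d : 'rV[R]_k) : (\rank (diag_mx d) <= #|[set j | d 0%R j != 0%R]|)%N.
Proof.
rewrite diag_mx_sum_delta (bigID (fun j => d 0 j != 0)) /= [X in _ + X]big1; last first.
  by move=> j; rewrite negbK => /eqP->; rewrite scale0r.
rewrite addr0 -sum1dep_card.
elim/big_ind2: _ => [|p A q B pA qB|j _]; first by rewrite mxrank0.
  by apply: leq_trans (mxrank_add _ _) _; exact: leq_add.
apply: leq_trans (_ : (\rank (delta_mx j j : 'M[R]_k) <= 1)%N).
  by apply: mxrankS; exact: scalemx_sub.
by rewrite mxrank_delta.
Qed.

Lemma col_diag_row_sum m n k (U : 'M[R]_(m, k)) (d : 'rV_k) (V : 'M_(n, k)) :
  U *m diag_mx d *m V^T = \sum_j d 0 j *: (col j U *m (col j V)^T).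
Proof.
apply/matrixP => i l; rewrite mxE summxE; apply: eq_bigr => j _.
by rewrite mul_mx_diag !mxE big_ord1 !mxE mulrCA mulrA.
Qed.

(** The columns of [M] are [A (u_j v_j^T)]. A coefficient vector with at most [2 r] nonzero entries
    gives a matrix of rank at most [2 r] and of the same norm, so the matrix RIP becomes
    [sparse_rip], and [A H = 0] puts [s] in the kernel of [M]. *)
Lemma svd_null_space m n q r k (A : {linear 'M[R]_(m, n) -> 'cV[R]_q}) (d : R)
    (H : 'M[R]_(m, n)) U (s : 'rV_k) V T t :
  (forall X : 'M_(m, n), (\rank X <= 2 * r)%N ->
     (1 - d) * frob X X <= frob (A X) (A X) <= (1 + d) * frob X X) ->
  0 <= d -> d < 4404%:R / 10000%:R -> is_svd H U s V -> A H = 0 ->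
  is_top (s 0) r T t ->
  11%:R / 10%:R * \sum_(j in T) s 0 j <= \sum_(j | j \notin T) s 0 j.
Proof.
move=> rip d_ge0 d_lt [UU VV s_gt0 HE] AH topT.
pose M : 'M[R]_(q, k) := \matrix_(i, j) A (col j U *m (col j V)^T) i 0.
have ME (x : 'cV_k) : M *m x = A (U *m diag_mx x^T *m V^T).
  rewrite col_diag_row_sum linear_sum; apply/colP => i; rewrite mxE summxE.
  by apply: eq_bigr => j _; rewrite linearZ !mxE mulrC.
apply: (rip_null_space (M := M) (d := d) _ d_ge0 d_lt _ topT).
- move=> x x_supp; rewrite ME.
  have -> : frob x x = frob (U *m diag_mx x^T *m V^T) (U *m diag_mx x^T *m V^T).
    by rewrite frob_diag_svd // frob_col; apply: eq_bigr => j _; rewrite mxE expr2.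
  apply: rip; apply: leq_trans (mxrankM_maxl _ _) _.
  apply: leq_trans (mxrankM_maxr _ _) _; apply: leq_trans (mxrank_diag_le _) _.
  by apply: leq_trans x_supp; apply/subset_leq_card/subsetP => j; rewrite !inE mxE.
- by move=> j; exact: ltW.
- rewrite ME -AH HE; congr (A (_ *m diag_mx _ *m _)).
  by apply/rowP => j; rewrite !mxE.
Qed.

Theorem svd_recovery m n q r r0 k l (A : {linear 'M[R]_(m, n) -> 'cV[R]_q}) (d : R)
    (X Y : 'M[R]_(m, n)) P (sX : 'rV_r0) Q U (sH : 'rV_k) V B (sY : 'rV_l) D (b alpha : R) :
  (forall X : 'M_(m, n), (\rank X <= 2 * r)%N ->
     (1 - d) * frob X X <= frob (A X) (A X) <= (1 + d) * frob X X) ->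
  0 <= d -> d < 4404%:R / 10000%:R ->
  is_svd X P sX Q -> is_svd (Y - X) U sH V -> is_svd Y B sY D ->
  (r0 <= r)%N -> A Y = A X -> Y != X ->
  0 <= b -> (forall i, sX 0 i <= b) -> 0 < alpha -> 10%:R * b <= alpha ->
  \sum_i sX 0 i + frob X X / (2 * alpha) < \sum_i sY 0 i + frob Y Y / (2 * alpha).
Proof.
move=> rip d_ge0 d_lt svdX svdH svdY r0r AYX YX b_ge0 sX_le alpha_gt0 b_le.
have sH_gt0 : forall j, 0 < sH 0 j by case: svdH.
have [T [t topT]] := is_top_exists r (fun j => ltW (sH_gt0 j)).
have AH : A (Y - X) = 0 by rewrite linearB AYX subrr.
have nsp := svd_null_space rip d_ge0 d_lt svdH AH topT.
have YE : Y = X + (Y - X) by rewrite addrC subrK.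
rewrite [in X in is_svd X]YE in svdY.
have le_r (c : 'I_k -> R) : \sum_j c j <= r0%:R -> \sum_j c j <= r%:R.
  by move/le_trans; apply; rewrite ler_nat.
have [c [c01 /le_r sumc pert]] := svd_sum_perturb svdX svdH svdY.
have [c' [c'01 /le_r sumc' cross]] := frob_svd_ge svdX svdH sX_le.
have topc := is_top_sum topT c01 sumc.
have topc' := is_top_sum topT c'01 sumc'.
set a := \sum_(j in T) _ in nsp topc topc'.
have sumH : \sum_j sH 0 j = a + \sum_(j | j \notin T) sH 0 j.
  by rewrite (bigID [in T]).
have a_ge0 : 0 <= a by apply: sumr_ge0 => j _; exact: ltW.
have HH_gt0 : 0 < frob (Y - X) (Y - X) by rewrite lt_def frob_ge0 frob_eq0 subr_eq0 YX.
have YY : frob Y Y = frob X X + 2 * frob X (Y - X) + frob (Y - X) (Y - X).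
  by rewrite !frobDl !frobDr !frobNl !frobNr (frobC Y X); ring.
have crossb : - (alpha * a) <= 10%:R * frob X (Y - X).
  have := ler_wpM2l b_ge0 topc'; have := ler_wpM2r a_ge0 b_le; lra.
(* The quadratic term loses less than [a / 10], strictly since [Y != X]; the nuclear norm gains at
   least the tail sum minus [a], hence at least [a / 10]. *)
have diff : frob Y Y / (2 * alpha) - frob X X / (2 * alpha) > - (a / 10%:R).
  rewrite -mulrBl ltr_pdivlMr ?mulr_gt0 // YY; lra.
by move: diff pert nsp topc; rewrite sumH; lra.
Qed.
End RealMatrices.

(** * The real elements of a numeric closed field *)

Record realOf (C : numClosedFieldType) :=
  RealOf { realVal : C; realValP : realVal \is Num.real }.

HB.instance Definition _ (C : numClosedFieldType) :=
  [isSub for @realVal C].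
HB.instance Definition _ (C : numClosedFieldType) :=
  [Choice of realOf C by <:].
HB.instance Definition _ (C : numClosedFieldType) :=
  [SubChoice_isSubIntegralDomain of realOf C by <:].
HB.instance Definition _ (C : numClosedFieldType) :=
  [SubIntegralDomain_isSubField of realOf C by <:].

Section RealOrder.
Variable C : numClosedFieldType.
Implicit Types x y : realOf C.

Definition realOf_le x y := val x <= val y.
Definition realOf_lt x y := val x < val y.
Definition realOf_norm x : realOf C := RealOf (normr_real (val x)).

Fact realOf_le0_add x y : realOf_le 0 x -> realOf_le 0 y -> realOf_le 0 (x + y).
Proof. exact: addr_ge0. Qed.
Fact realOf_le0_mul x y : realOf_le 0 x -> realOf_le 0 y -> realOf_le 0 (x * y).
Proof. exact: mulr_ge0. Qed.
Fact realOf_le0_anti x : realOf_le 0 x -> realOf_le x 0 -> x = 0.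
Proof. by move=> x0 x1; apply/val_inj/le_anti/andP; split. Qed.
Fact realOf_sub_ge0 x y : realOf_le 0 (y - x) = realOf_le x y.
Proof. exact: subr_ge0. Qed.
Fact realOf_le0_total x : realOf_le 0 x || realOf_le x 0.
Proof. exact: (realValP x). Qed.
Fact realOf_normN x : realOf_norm (- x) = realOf_norm x.
Proof. by apply/val_inj; exact: normrN. Qed.
Fact realOf_ge0_norm x : realOf_le 0 x -> realOf_norm x = x.
Proof. by move=> x0; apply/val_inj; exact: ger0_norm. Qed.
Fact realOf_lt_def x y : realOf_lt x y = (y != x) && realOf_le x y.
Proof. exact: lt_def. Qed.

HB.instance Definition _ := Num.IntegralDomain_isLeReal.Build (realOf C)
  realOf_le0_add realOf_le0_mul realOf_le0_anti realOf_sub_ge0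
  realOf_le0_total realOf_normN realOf_ge0_norm realOf_lt_def.

End RealOrder.

HB.instance Definition _ (C : numClosedFieldType) :=
  GRing.RMorphism.copy (@realVal C) (\val : realOf C -> C).

Lemma realVal_le (C : numClosedFieldType) (x y : realOf C) :
  (realVal x <= realVal y) = (x <= y).
Proof. by []. Qed.

Lemma realVal_lt (C : numClosedFieldType) (x y : realOf C) :
  (realVal x < realVal y) = (x < y).
Proof. by []. Qed.

(** * Square roots, eigenvalues and the SVD over the real elements *)

Section Transfer.
Variable C : numClosedFieldType.
Local Notation R := (realOf C).
Local Notation toC := (map_mx (@realVal C)).

Lemma realOf_sqrt (x : R) : 0 <= x -> exists2 y : R, 0 <= y & y ^+ 2 = x.
Proof.
move=> x_ge0; have x_ge0' : 0 <= realVal x by [].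
exists (RealOf (sqrtC_real x_ge0')); first by rewrite /(_ <= _) /= /realOf_le /= sqrtC_ge0.
by apply/val_inj; rewrite rmorphXn; exact: sqrtCK.
Qed.

Lemma toC_conj m n (X : 'M[R]_(m, n)) : map_mx Num.conj (toC X) = toC X.
Proof. by apply/matrixP => i j; rewrite !mxE; apply/CrealP/realValP. Qed.

Lemma toC_inj m n : injective (fun X : 'M[R]_(m, n) => toC X).
Proof.
move=> X Y /matrixP XY; apply/matrixP => i j; apply/val_inj.
by have := XY i j; rewrite !mxE.
Qed.

Lemma symmetric_hermsymmx n (S : 'M[R]_n) : S^T = S -> toC S \is hermsymmx.
Proof.
move=> ST; apply/is_hermitianmxP; rewrite expr0 scale1r.
by rewrite map_trmx ST toC_conj.
Qed.

Lemma spectralmx_mul n (S : 'M[R]_n) : S^T = S ->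
  spectralmx (toC S) *m toC S = diag_mx (spectral_diag (toC S)) *m spectralmx (toC S).
Proof.
move=> /symmetric_hermsymmx/hermitian_normalmx/orthomx_spectralP SE.
by rewrite {2}SE !mulmxA mulmxV ?spectral_unit // mul1mx.
Qed.

(** Diagonalization only gives eigenvectors over [C]. The eigenvalue is real because the matrix is
    Hermitian; as a root of the characteristic polynomial it is also an eigenvalue over [R], with a
    real eigenvector. *)
Lemma symmetric_eigenvalue n (S : 'M[R]_n) : S^T = S -> S != 0 ->
  exists (a : R) (v : 'cV_n), [/\ a != 0, v != 0 & S *m v = a *: v].
Proof.
move=> ST SN0; have PS := spectralmx_mul ST; have SH := symmetric_hermsymmx ST.
set P := spectralmx _ in PS; set d := spectral_diag _ in PS.
have Punit : P \in unitmx := spectral_unit _.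
have [j dj|d0] := pickP (fun j => d 0 j != 0); last first.
  case/eqP: SN0; apply: toC_inj; rewrite map_mx0 -[LHS](mulKmx Punit) PS.
  have -> : d = 0 by apply/rowP => j; have /negbFE/eqP := d0 j; rewrite mxE.
  by rewrite linear0 mul0mx mulmx0.
have dj_real : d 0 j \is Num.real by apply/mxOverP/hermitian_spectral_diag_real.
pose a : R := RealOf dj_real.
have : eigenvalue S a.
  rewrite eigenvalue_root_char -(fmorph_root (@realVal C)) map_char_poly.
  rewrite -eigenvalue_root_char; apply/eigenvalueP; exists (row j P).
    by rewrite -row_mul PS row_mul row_diag_mx -scalemxAl -rowE.
  apply/eqP => /(congr1 (mulmx^~ (invmx P))); rewrite -row_mul mulmxV // mul0mx.
  by move/rowP/(_ j); rewrite !mxE eqxx => /eqP; rewrite oner_eq0.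
case/eigenvalueP => v vS vN0; exists a, v^T; split.
- by [].
- by rewrite -(inj_eq (@trmx_inj _ _ _)) trmxK trmx0.
- by rewrite -[S]ST -trmx_mul vS linearZ.
Qed.

(** [v] is a unit eigenvector of [X^T X] for an eigenvalue [a != 0], which is positive because
    [a |v|^2 = |X v|^2]; then [s] is the root of [a] and [u = X v / s]. *)
Lemma singular_triple m n (X : 'M[R]_(m, n)) : X != 0 ->
  exists (s : R) (u : 'cV_m) (v : 'cV_n),
    [/\ 0 < s, u^T *m u = 1%:M, v^T *m v = 1%:M, X *m v = s *: u & X^T *m u = s *: v].
Proof.
move=> XN0.
have [||a [v [aN0 vN0 Xv]]] := @symmetric_eigenvalue _ (X^T *m X).
- by rewrite trmx_mul trmxK.
- by apply: contraNneq XN0 => XX; rewrite -frob_eq0 /frob XX mxtrace0.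
have vv_gt0 : 0 < frob v v by rewrite lt_def frob_ge0 frob_eq0 vN0.
have Xvv : frob (X *m v) (X *m v) = a * frob v v.
  by rewrite frob_mull mulmxA Xv frobZr.
have a_gt0 : 0 < a.
  by rewrite lt_def aN0 -(pmulr_lge0 _ vv_gt0) -Xvv frob_ge0.
have [s s_ge0 sE] := realOf_sqrt (ltW a_gt0).
have [l l_ge0 lE] := realOf_sqrt (ltW vv_gt0).
have sN0 : s != 0 by apply: contraNneq aN0 => s0; rewrite -sE s0 expr0n.
have lN0 : l != 0.
  by apply: contraTneq vv_gt0 => l0; rewrite -lE l0 expr0n ltxx.
exists s, ((s * l)^-1 *: (X *m v)), (l^-1 *: v); split.
- by rewrite lt_def sN0.
- rewrite mx11_frob frobZl frobZr Xvv -sE -lE; congr (_%:M); field.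
  by rewrite sN0 lN0.
- by rewrite mx11_frob frobZl frobZr -lE; congr (_%:M); field.
- by rewrite -scalemxAr scalerA; congr (_ *: _); field; rewrite sN0 lN0.
- rewrite -scalemxAr mulmxA Xv !scalerA -sE; congr (_ *: _); field.
  by rewrite sN0 lN0.
Qed.

(** Deflation: subtracting a singular triple lowers the rank, and the SVD of the remainder is
    orthogonal to the triple. *)
Lemma svd_exists m n (X : 'M[R]_(m, n)) :
  exists k (U : 'M_(m, k)) (s : 'rV_k) (V : 'M_(n, k)), is_svd X U s V.
Proof.
have [p] := ubnP (\rank X); elim: p X => // p IHp X Xp.
have [->|XN0] := eqVneq X 0.
  exists 0%N, 0, 0, 0; split; rewrite ?mul0mx //; try by apply/matrixP => -[].
  by case.
have [s [u [v [s_gt0 uu vv Xv Xu]]]] := singular_triple XN0.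
pose X' := X - s *: (u *m v^T).
have X'v : X' *m v = 0 by rewrite mulmxBl Xv -scalemxAl -mulmxA vv mulmx1 subrr.
have uX' : u^T *m X' = 0.
  rewrite mulmxBr -scalemxAr mulmxA uu mul1mx -[X in u^T *m X]trmxK -trmx_mul Xu.
  by rewrite linearZ subrr.
have vX : v^T = s^-1 *: (u^T *m X).
  rewrite -[X in u^T *m X]trmxK -trmx_mul Xu linearZ scalerA mulVf ?gt_eqF //.
  by rewrite scale1r.
have vsubX : (v^T <= X)%MS by rewrite vX scalemx_sub // submxMl.
have X'X : (X' < X)%MS.
  rewrite ltmxE; apply/andP; split.
    by rewrite addmx_sub // eqmx_opp scalemx_sub // mulmx_sub.
  (* [X'] kills [v], so [v^T = D X'] would give [v^T v = 0]. *)
  apply: contraTN vsubX => XX'; apply/negP => /submx_trans/(_ XX')/submxP[D vD].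
  have := congr1 (mulmx^~ v) vD; rewrite vv -mulmxA X'v mulmx0.
  by move/matrixP/(_ 0 0); rewrite !mxE => /eqP; rewrite oner_eq0.
have [|k [U [t [V [UU VV t_gt0 X'E]]]]] := IHp X'.
  by apply: leq_trans (rank_ltmx X'X) _; rewrite -ltnS.
(* Since [diag_mx t] is invertible, [X' v = 0] and [u^T X' = 0] pass to the factors [V] and [U]. *)
have diagK : diag_mx (map_mx (@GRing.inv _) t) *m diag_mx t = 1%:M.
  rewrite mulmx_diag -diag_const_mx; congr diag_mx.
  by apply/rowP => j; rewrite !mxE mulVf // gt_eqF.
have Vv : V^T *m v = 0.
  have := congr1 (mulmx (diag_mx (map_mx (@GRing.inv _) t) *m U^T)) X'v.
  rewrite X'E mulmx0 -!mulmxA (mulmxA U^T U) UU mul1mx (mulmxA _ (diag_mx t)).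
  by rewrite diagK mul1mx.
have uU : u^T *m U = 0.
  have := congr1 (mulmx^~ (V *m diag_mx (map_mx (@GRing.inv _) t))) uX'.
  rewrite X'E mul0mx -!mulmxA (mulmxA V^T V) VV mul1mx.
  by rewrite diag_mxC diagK mulmx1.
exists (1 + k)%N, (row_mx u U), (row_mx s%:M t), (row_mx v V); split.
- rewrite tr_row_mx mul_col_row uu UU uU -[U^T *m u]trmxK trmx_mul trmxK uU trmx0.
  by rewrite -scalar_mx_block.
- rewrite tr_row_mx mul_col_row vv VV Vv -[v^T *m V]trmxK trmx_mul trmxK Vv trmx0.
  by rewrite -scalar_mx_block.
- move=> j; rewrite mxE; case: splitP => i _; last exact: t_gt0.
  by rewrite !mxE !ord1 eqxx.
rewrite diag_mx_row mul_row_block tr_row_mx mul_row_col !mulmx0 addr0 add0r.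
have -> : diag_mx (s%:M : 'rV_1) = s%:M.
  by apply/matrixP => i j; rewrite !mxE !ord1.
by rewrite -X'E mul_mx_scalar -scalemxAl addrC subrK.
Qed.

(** * Nuclear and spectral norms *)

Lemma gram_diag m n (A : 'M[C]_(m, n)) i :
  ((map_mx Num.conj A)^T *m A) i i = \sum_j `|A j i| ^+ 2.
Proof. by rewrite mxE; apply: eq_bigr => j _; rewrite !mxE normCK mulrC. Qed.

Lemma gramT_diag m n (A : 'M[C]_(m, n)) j :
  (A *m (map_mx Num.conj A)^T) j j = \sum_i `|A j i| ^+ 2.
Proof. by rewrite mxE; apply: eq_bigr => i _; rewrite !mxE normCK. Qed.

Section SingularValues.
Variables (m n k : nat) (X : 'M[R]_(m, n)) (U : 'M[R]_(m, k)) (s : 'rV[R]_k).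
Variables (V : 'M[R]_(n, k)) (svdX : is_svd X U s V).

Let S := X^T *m X.
Let P := spectralmx (toC S).
Let d := spectral_diag (toC S).
(* Coordinates of the right singular vectors in the chosen spectral basis; a nonzero
   entry forces the corresponding singular values to agree. *)
Let T := P *m toC V.

Let singvalsE j : singvals (toC X) 0 j = sqrtC (d 0 j).
Proof. by rewrite mxE toC_conj map_trmx -map_mxM. Qed.

Let SV : S *m V = V *m diag_mx (\row_i s 0 i ^+ 2).
Proof.
have [UU VV _ XE] := svdX.
rewrite /S XE !trmx_mul trmxK tr_diag_mx -!mulmxA VV mulmx1 (mulmxA U^T) UU mul1mx.
by rewrite mulmx_diag; congr (_ *m diag_mx _); apply/rowP => i; rewrite !mxE expr2.
Qed.

Let PS : P *m toC S = diag_mx d *m P.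
Proof. by apply: spectralmx_mul; rewrite trmx_mul trmxK. Qed.

Let PP : P *m (map_mx Num.conj P)^T = 1%:M.
Proof.
rewrite map_trmx; apply/unitarymxP; exact: spectral_unitarymx.
Qed.

Let Tconj : (map_mx Num.conj T)^T = toC V^T *m (map_mx Num.conj P)^T.
Proof. by rewrite map_mxM /= trmx_mul toC_conj [(toC V)^T]map_trmx. Qed.

Let T_eq0 j i : T j i != 0 -> sqrtC (d 0 j) = realVal (s 0 i).
Proof.
have [_ _ s_gt0 _] := svdX => TN0.
have : diag_mx d *m T = T *m toC (diag_mx (\row_i s 0 i ^+ 2)).
  by rewrite /T mulmxA -PS -!mulmxA -!map_mxM SV.
move=> /matrixP/(_ j i); rewrite map_diag_mx mul_diag_mx mul_mx_diag [LHS]mxE [RHS]mxE mulrC.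
move=> /(mulfI TN0) ->; rewrite 2!mxE rmorphXn sqrCK //.
exact: (ltW (s_gt0 i)).
Qed.

Let col_sum i : \sum_j `|T j i| ^+ 2 = 1.
Proof.
have [_ VV _ _] := svdX.
have : (map_mx Num.conj T)^T *m T = 1%:M.
  rewrite Tconj /T mulmxA -(mulmxA _ _ P) (mulmx1C PP) mulmx1 -map_mxM VV.
  exact: map_mx1.
move=> /matrixP/(_ i i); rewrite gram_diag => ->.
by rewrite mxE eqxx.
Qed.

(** By [S V V^T = S], spectral vectors with nonzero eigenvalue lie in the span of the columns of
    [V]; those in the kernel are orthogonal to it. *)
Let row_sum j : d 0 j != 0 -> \sum_i `|T j i| ^+ 2 = 1.
Proof.
have [UU VV _ XE] := svdX => dN0.
have XVV : X *m (V *m V^T) = X.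
  by rewrite XE -!mulmxA (mulmxA V^T V) VV mul1mx.
have SVV : S *m (V *m V^T) = S by rewrite /S -mulmxA XVV.
have : diag_mx d *m (T *m (map_mx Num.conj T)^T) = diag_mx d.
  transitivity (P *m toC (S *m (V *m V^T)) *m (map_mx Num.conj P)^T).
    by rewrite Tconj (map_mxM _ S) (map_mxM _ V) !mulmxA PS.
  by rewrite SVV PS -mulmxA PP mulmx1.
move=> /matrixP/(_ j j); rewrite mul_diag_mx [LHS]mxE [RHS]mxE eqxx mulr1n.
by move=> /(canRL (mulKf dN0)); rewrite mulVf // gramT_diag.
Qed.

(** Both sides equal [\sum_j \sum_i s_i |T_ji|^2]: row sums give the left one, column sums the right
    one. *)
Lemma nucnorm_svd : nucnorm (toC X) = realVal (\sum_i s 0 i).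
Proof.
transitivity (\sum_j \sum_i realVal (s 0 i) * `|T j i| ^+ 2).
  apply: eq_bigr => j _; rewrite singvalsE.
  have -> : sqrtC (d 0 j) = sqrtC (d 0 j) * \sum_i `|T j i| ^+ 2.
    have [->|/row_sum->] := eqVneq (d 0 j) 0; first by rewrite sqrtC0 mul0r.
    by rewrite mulr1.
  rewrite mulr_sumr; apply: eq_bigr => i _.
  have [->|/T_eq0->//] := eqVneq (T j i) 0.
  by rewrite normr0 expr0n !mulr0.
rewrite exchange_big rmorph_sum; apply: eq_bigr => i _ /=.
by rewrite -mulr_sumr col_sum mulr1.
Qed.

(** Each [d_j] is 0 or some [s_i^2]. This makes the singular values comparable in the partially
    ordered [C], which the maximum in [specnorm] calls for. *)
Lemma singvals_ge0 j : 0 <= singvals (toC X) 0 j.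
Proof.
rewrite singvalsE sqrtC_ge0; have [->//|dN0] := eqVneq (d 0 j) 0.
have [i TN0|T0] := pickP (fun i => T j i != 0).
  rewrite -sqrtC_ge0 (T_eq0 TN0); have [_ _ s_gt0 _] := svdX; exact: ltW (s_gt0 i).
have /eqP := row_sum dN0; rewrite big1 ?[0 == 1]eq_sym ?oner_eq0 // => i _.
by have /negbFE/eqP-> := T0 i; rewrite normr0 expr0n.
Qed.

Lemma specnorm_bound : specnorm (toC X) \is Num.real /\
  0 <= specnorm (toC X) /\ forall i, realVal (s 0 i) <= specnorm (toC X).
Proof.
have bigmax (r : seq 'I_n) : let b := \big[Num.max/0]_(j <- r) singvals (toC X) 0 j in
    0 <= b /\ forall j, j \in r -> singvals (toC X) 0 j <= b.
  elim: r => [|j r /= [b_ge0 le_b]]; first by rewrite big_nil.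
  rewrite big_cons; set b := bigop.body _ _ _ in b_ge0 le_b *.
  have cmp : singvals (toC X) 0 j >=< b.
    by rewrite real_comparable // ger0_real // singvals_ge0.
  rewrite comparable_le_max // b_ge0 orbT; split=> // i.
  by rewrite inE comparable_le_max // => /orP[/eqP->|/le_b->]; rewrite ?lexx ?orbT.
have [spec_ge0 le_spec] := bigmax (index_enum 'I_n).
split; first exact: ger0_real.
split=> // i.
have [j TN0|T0] := pickP (fun j => T j i != 0).
  by rewrite -(T_eq0 TN0) -singvalsE; apply: le_spec; rewrite mem_index_enum.
have /eqP := col_sum i; rewrite big1 ?[0 == 1]eq_sym ?oner_eq0 // => j _.
by have /negbFE/eqP-> := T0 j; rewrite normr0 expr0n.
Qed.

End SingularValues.

(** * Norms and linear maps carried between [C] and its real elements *)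

Lemma normr_realVal_sqr (x : R) : `|realVal x| ^+ 2 = realVal (x * x).
Proof. by rewrite real_normK ?realValP // expr2 rmorphM. Qed.

Lemma frob2_toC m n (X : 'M[R]_(m, n)) : frob2 (toC X) = realVal (frob X X).
Proof.
rewrite frobE rmorph_sum; apply: eq_bigr => i _; rewrite rmorph_sum.
by apply: eq_bigr => j _; rewrite mxE normr_realVal_sqr.
Qed.

Lemma vnorm2_toC m (v : 'cV[R]_m) : vnorm2 (toC v) = realVal (frob v v).
Proof.
rewrite frob_col rmorph_sum; apply: eq_bigr => i _.
by rewrite mxE normr_realVal_sqr.
Qed.

Lemma realmat_toC m n (X : 'M[C]_(m, n)) : realmat X -> exists X' : 'M[R]_(m, n), X = toC X'.
Proof.
move=> Xr; exists (\matrix_(i, j) RealOf (Xr i j)).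
by apply/matrixP => i j; rewrite !mxE.
Qed.

Lemma toC_realmat m n (X : 'M[R]_(m, n)) : realmat (toC X).
Proof. by move=> i j; rewrite mxE realValP. Qed.

Lemma real_linear_restrict m n q (A : {linear 'M[C]_(m, n) -> 'cV[C]_q}) :
  (forall X : 'M[C]_(m, n), realmat X -> realvec (A X)) ->
  exists A' : {linear 'M[R]_(m, n) -> 'cV[R]_q}, forall X, toC (A' X) = A (toC X).
Proof.
move=> A_real.
pose A' (X : 'M[R]_(m, n)) : 'cV[R]_q := \col_i RealOf (A_real _ (toC_realmat X) i).
have A'E X : toC (A' X) = A (toC X).
  by apply/colP => i; rewrite !mxE.
have A'lin : linear A'.
  move=> a X Y; apply: toC_inj.
  by rewrite /= map_mxD map_mxZ !A'E map_mxD map_mxZ linearP.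
by exists (HB.pack_for {linear 'M[R]_(m, n) -> 'cV[R]_q} A'
  (GRing.isLinear.Build _ _ _ _ A' A'lin)).
Qed.

End Transfer.

Theorem mainTheorem10 (C : numClosedFieldType) (n1 n2 m r : nat)
  (A : {linear 'M[C]_(n1, n2) -> 'cV[C]_m})
  (A_real : forall X : 'M[C]_(n1, n2), realmat X -> realvec (A X))
  (X0 : 'M[C]_(n1, n2)) (X0_real : realmat X0) (X0_rank : (\rank X0 <= r)%N)
  (delta : C) (Hdelta : RIP_const A (2 * r)%N delta)
  (Hdelta_lt : delta < 4404%:R / 10000%:R)
  (alpha : C) (alpha_real : alpha \is Num.real) (alpha_pos : 0 < alpha)
  (Halpha : 10%:R * specnorm X0 <= alpha) :
  unique_sol_N2 A (A X0) alpha X0.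
Proof.
split=> //; split=> // Y Y_real AY YX0.
have [X' X0E] := realmat_toC X0_real; have [Y' YE] := realmat_toC Y_real.
have [A' A'E] := real_linear_restrict A_real.
have [k0 [P [sX [Q svdX]]]] := svd_exists X'.
have [k1 [B [sY [D svdY]]]] := svd_exists Y'.
have [k [U [sH [V svdH]]]] := svd_exists (Y' - X').
have [d_ge0 [rip _]] := Hdelta.
have [spec_real [spec_ge0 spec_le]] := specnorm_bound svdX.
pose d := RealOf (ger0_real d_ge0); pose a := RealOf alpha_real.
pose b := RealOf spec_real.
have objE k' (Z : 'M[realOf C]_(n1, n2)) L (s : 'rV_k') M : is_svd Z L s M ->
    objN2 alpha (map_mx (@realVal C) Z) =
    realVal (\sum_i s 0 i + frob Z Z / (2 * a)).
  move=> svdZ; rewrite /objN2 (nucnorm_svd svdZ) frob2_toC.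
  by rewrite rmorphD fmorph_div rmorphM rmorph_nat.
rewrite X0E YE (objE _ _ _ _ _ svdX) (objE _ _ _ _ _ svdY).
(* Extension of scalars preserves rank and norms, so the RIP of [A] passes to [A']. *)
have ripR (Z : 'M[realOf C]_(n1, n2)) : (\rank Z <= 2 * r)%N ->
    (1 - d) * frob Z Z <= frob (A' Z) (A' Z) <= (1 + d) * frob Z Z.
  rewrite -(mxrank_map (@realVal C)) => /(rip _ (toC_realmat Z)).
  rewrite -A'E vnorm2_toC frob2_toC -[delta]/(realVal d) -(rmorph1 (@realVal C)).
  by rewrite -rmorphB -rmorphD -!rmorphM !realVal_le => -[-> ->].
have d_ltR : d < 4404%:R / 10000%:R.
  by rewrite -realVal_lt fmorph_div !rmorph_nat.
have b_le : 10%:R * b <= a.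
  by rewrite -realVal_le rmorphM rmorph_nat /= -X0E.
have k0r : (k0 <= r)%N.
  by apply: leq_trans (svd_size_le_rank svdX) _; rewrite -(mxrank_map (@realVal C)) -X0E.
have A'Y : A' Y' = A' X' by apply: toC_inj; rewrite /= !A'E -X0E -YE.
have YX' : Y' != X' by apply: contraNneq YX0 => YX; rewrite YE X0E YX.
rewrite realVal_lt.
exact: (@svd_recovery _ _ _ _ _ _ _ _ A' d _ _ _ _ _ _ _ _ _ _ _ b a
  ripR d_ge0 d_ltR svdX svdH svdY k0r A'Y YX' spec_ge0 spec_le alpha_pos b_le).
Qed.
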